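(* Let $X,Y$ be nonempty sets and let $F\colon X^*\to Y$ be a function. The following assertions are equivalent. (i) $F$ is strongly B-preassociative. (ii) For all $\mathbf{x},\mathbf{x}'\in X^*$ with $|\mathbf{x}|=|\mathbf{x}'|$ and every $K\subseteq\{1,\ldots,|\mathbf{x}|\}$, with $K^c=\{1,\ldots,|\mathbf{x}|\}\setminus K$, we have $$F(\mathbf{x}|_K)=F(\mathbf{x}'|_K)\ \text{ and }\ F(\mathbf{x}|_{K^c})=F(\mathbf{x}'|_{K^c})\ \Rightarrow\ F(\mathbf{x})=F(\mathbf{x}').$$ (iii) For all $\mathbf{x},\mathbf{x}',\mathbf{y},\mathbf{z},\mathbf{z}'\in X^*$ we have $$|\mathbf{x}|=|\mathbf{x}'|,\ |\mathbf{z}|=|\mathbf{z}'|,\ \text{ and }\ F(\mathbf{x}\mathbf{z})=F(\mathbf{x}'\mathbf{z}')\ \Rightarrow\ F(\mathbf{x}\mathbf{y}\mathbf{z})=F(\mathbf{x}'\mathbf{y}\mathbf{z}').$$ Moreover, we may assume that $|\mathbf{y}|=1$ in assertion (iii), i.e., the assertion obtained from (iii) by restricting to $\mathbf{y}$ with $|\mathbf{y}|=1$ is also equivalent to (i).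
   Context: $X^*=\bigcup_{n\geqslant 0}X^n$ is the set of all strings (finite words) over $X$, with $X^0=\{\varepsilon\}$, $\varepsilon$ being the empty string; juxtaposition is concatenation and $|\mathbf{x}|$ is the length of $\mathbf{x}$. For $\mathbf{x}=x_1\cdots x_n\in X^n$ and $K\subseteq\{1,\ldots,n\}$, $\mathbf{x}|_K$ is the string obtained from $\mathbf{x}$ by removing all letters $x_i$ with $i\notin K$. $F\colon X^*\to Y$ is strongly B-preassociative (strongly barycentrically preassociative) if for every $\mathbf{x}\in X^*$, every $\mathbf{x}'\in X^{|\mathbf{x}|}$ and every $K\subseteq\{1,\ldots,|\mathbf{x}|\}$ (with $K^c$ the complement of $K$ in $\{1,\ldots,|\mathbf{x}|\}$), $$F(\mathbf{x}|_K)=F(\mathbf{x}'|_K)\ \text{ and }\ \mathbf{x}'|_{K^c}=\mathbf{x}|_{K^c}\ \Rightarrow\ F(\mathbf{x})=F(\mathbf{x}').$$ *)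

(* Defs.v *)
From mathcomp Require Import all_boot.
Set Implicit Arguments.
Unset Strict Implicit.
Unset Printing Implicit Defensive.

(* Strings over X are sequences, X^* = seq X, and X^n = n.-tuple X; positions
   are numbered from 0 to n - 1 instead of 1 to n. *)

(* x|_K. The enumeration of a set of ordinals is increasing, so the letters
   kept appear in the same order as in x. *)
Definition restr (X : Type) (n : nat) (x : n.-tuple X) (K : {set 'I_n}) : seq X :=
  [seq tnth x i | i <- enum K].

Definition strongly_B_preassociative (X Y : Type) (F : seq X -> Y) : Prop :=
  forall (n : nat) (x x' : n.-tuple X) (K : {set 'I_n}),
    F (restr x K) = F (restr x' K) -> restr x' (~: K) = restr x (~: K) ->
    F x = F x'.

(* Main.v *)
(* A string with letters from [x] on [K] and from [x'] off [K] links [x] to [x']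
   in two applications of (i), one with [K] and one with its complement; this
   gives (ii).  Conversely, if [x] and [x'] agree off [K], then the letters at
   these common positions can be inserted one at a time, from left to right,
   into [x|_K] and [x'|_K], each insertion being an instance of (iii) with
   [|y| = 1]. *)

Require Import Defs.
From mathcomp Require Import all_boot.

Set Implicit Arguments.
Unset Strict Implicit.
Unset Printing Implicit Defensive.

Lemma restr_mask (X : Type) (n : nat) (x : n.-tuple X) (K : {set 'I_n}) :
  restr x K = mask [seq i \in K | i <- enum 'I_n] x.
Proof.
rewrite /restr -[X in mask _ X](map_tnth_enum x) -map_mask -filter_mask.
by rewrite [in RHS]enumT.
Qed.

Lemma restr_eq_in (X : Type) (n : nat) (x x' : n.-tuple X) (K : {set 'I_n}) :
  {in K, tnth x =1 tnth x'} -> restr x K = restr x' K.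
Proof. by move=> xx'; apply/eq_in_map => i; rewrite mem_enum => /xx'. Qed.

(** Bit masks describe sets of positions without dependent types, so the property can be applied to
    concatenations and proved by induction on the mask. Nothing is lost, since every mask lists
    membership in the set of its true positions. *)
Lemma strongly_B_preassociative_maskP (X Y : Type) (F : seq X -> Y) :
  strongly_B_preassociative F <->
  (forall (m : bitseq) (x x' : seq X), size x = size m -> size x' = size m ->
     F (mask m x) = F (mask m x') ->
     mask (map negb m) x' = mask (map negb m) x ->
     F x = F x').
Proof.
split=> [Fi m x x' sx sx' FK xKc | Fm n x x' K FK xKc].
  pose K := [set i : 'I_(size m) | nth false m i].
  have mK : [seq i \in K | i <- enum 'I_(size m)] = m.
    rewrite -[RHS](mkseq_nth false) /mkseq -val_enum_ord -map_comp.
    by apply: eq_map => i; rewrite /= inE.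
  have mKc : [seq i \in ~: K | i <- enum 'I_(size m)] = map negb m.
    by rewrite -[in RHS]mK -map_comp; apply: eq_map => i; rewrite /= inE.
  have /eqP tx := sx; have /eqP tx' := sx'.
  apply: (Fi _ (Tuple tx) (Tuple tx') K).
    by rewrite !restr_mask mK.
  by rewrite !restr_mask mKc.
apply: (Fm [seq i \in K | i <- enum 'I_n]).
- by rewrite size_tuple size_map size_enum_ord.
- by rewrite size_tuple size_map size_enum_ord.
- by rewrite -!restr_mask.
have -> : map negb [seq i \in K | i <- enum 'I_n] =
          [seq i \in ~: K | i <- enum 'I_n].
  by rewrite -map_comp; apply: eq_map => i; rewrite /= inE.
by rewrite -!restr_mask.
Qed.

Lemma strongly_B_preassociative_restr (X Y : Type) (F : seq X -> Y)
    (n : nat) (x x' : n.-tuple X) (K : {set 'I_n}) :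
  strongly_B_preassociative F ->
  F (restr x K) = F (restr x' K) ->
  F (restr x (~: K)) = F (restr x' (~: K)) ->
  F x = F x'.
Proof.
move=> Fi FK FKc.
pose u := [tuple if i \in K then tnth x i else tnth x' i | i < n].
have uK : restr u K = restr x K.
  by apply: restr_eq_in => i iK; rewrite tnth_mktuple iK.
have uKc : restr u (~: K) = restr x' (~: K).
  by apply: restr_eq_in => i; rewrite inE tnth_mktuple => /negbTE ->.
(* [x] and [u] share their letters on [K], so the first step compares them off [K]; [u] and [x']
   share theirs off [K], so the second compares them on [K]. *)
transitivity (F u).
  by apply: (Fi _ _ _ (~: K)); rewrite ?setCK ?uKc.
by apply: (Fi _ _ _ K); rewrite ?uK ?uKc.
Qed.

Lemma strongly_B_preassociative_insert (X Y : Type) (F : seq X -> Y)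
    (x x' y z z' : seq X) :
  strongly_B_preassociative F ->
  size x = size x' -> size z = size z' ->
  F (x ++ z) = F (x' ++ z') ->
  F (x ++ y ++ z) = F (x' ++ y ++ z').
Proof.
move=> /strongly_B_preassociative_maskP Fm sx sz Fxz.
(* The mask keeps the two outer blocks, leaving [x ++ z], and its negation leaves the common block
   [y]. *)
pose m := nseq (size x) true ++ nseq (size y) false ++ nseq (size z) true.
apply: (Fm m).
- by rewrite !size_cat !size_nseq.
- by rewrite !size_cat !size_nseq sx sz.
- by rewrite !mask_cat ?size_nseq // !mask_false !mask_true ?sx ?sz //.
rewrite !map_cat !map_nseq /= !mask_cat ?size_nseq //.
by rewrite !mask_false !mask_true.
Qed.

Lemma insert1_strongly_B_preassociative (X Y : Type) (F : seq X -> Y) :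
  (forall x x' y z z' : seq X,
     size y = 1 -> size x = size x' -> size z = size z' ->
     F (x ++ z) = F (x' ++ z') ->
     F (x ++ y ++ z) = F (x' ++ y ++ z')) ->
  strongly_B_preassociative F.
Proof.
move=> Fins; apply/strongly_B_preassociative_maskP => m x x' sx sx' FK xKc.
(* The induction needs the prefixes [p] and [p'] already completed. *)
suff gen p p' : size p = size p' -> F (p ++ mask m x) = F (p' ++ mask m x') ->
    F (p ++ x) = F (p' ++ x') by exact: (gen [::] [::]).
elim: m x x' sx sx' {FK} xKc p p' => [|b m IHm] [|a x] [|a' x'] //=.
move=> [sx] [sx']; case: b => /= xKc p p' sp.
  (* At a kept position the letters [a] and [a'] may differ; they just move to the prefixes, and the
     equality under [F] is only reassociated. *)
  rewrite -!(cat_rcons _ p) -!(cat_rcons _ p'); apply: IHm => //.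
  by rewrite !size_rcons sp.
(* At a dropped position [xKc] forces [a' = a], and this letter has to be inserted right after the
   prefixes. *)
case: xKc => -> xKc Fp; rewrite -!cat_rcons; apply: IHm => //.
  by rewrite !size_rcons sp.
rewrite !cat_rcons -(cat1s a (mask m x)) -(cat1s a (mask m x')); apply: Fins => //.
(* Both masked tails have as many letters as [m] has true bits. *)
by rewrite !size_mask.
Qed.

Theorem proposition2p2 (X Y : Type) (hX : inhabited X) (hY : inhabited Y)
    (F : seq X -> Y) :
  (strongly_B_preassociative F <->
    (forall (n : nat) (x x' : n.-tuple X) (K : {set 'I_n}),
       F (restr x K) = F (restr x' K) ->
       F (restr x (~: K)) = F (restr x' (~: K)) ->
       F x = F x')) /\
  (strongly_B_preassociative F <->
    (forall x x' y z z' : seq X,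
       size x = size x' -> size z = size z' ->
       F (x ++ z) = F (x' ++ z') ->
       F (x ++ y ++ z) = F (x' ++ y ++ z'))) /\
  (strongly_B_preassociative F <->
    (forall x x' y z z' : seq X,
       size y = 1 ->
       size x = size x' -> size z = size z' ->
       F (x ++ z) = F (x' ++ z') ->
       F (x ++ y ++ z) = F (x' ++ y ++ z'))).
Proof.
split; last split.
- split=> [Fi n x x' K | Fii n x x' K FK xKc].
    exact: strongly_B_preassociative_restr.
  by apply: (Fii _ _ _ K); rewrite ?xKc.
- split=> [Fi x x' y z z' | Fiii].
    exact: strongly_B_preassociative_insert.
  by apply: insert1_strongly_B_preassociative => x x' y z z' _; apply: Fiii.
split=> [Fi x x' y z z' _ | ]; last exact: insert1_strongly_B_preassociative.
exact: strongly_B_preassociative_insert.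
Qed.
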